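(* Let $G$ and $H$ be two (Hausdorff) topological groups and let $X$ be a nonempty locally compact topological space. If $X$ is a topological coupling for $G$ and $H$, then it is a set theoretic coupling for $(G,\lambda_{\mathcal{K}})$ and $(H,\lambda'_{\mathcal{K}})$, where $\lambda_{\mathcal{K}}$ and $\lambda'_{\mathcal{K}}$ denote the group compact asymptotic resemblance relations on $G$ and $H$ respectively.
   Context: For a Hausdorff topological group $G$, let $\mathcal{K}$ be the family of all subsets of $G$ with compact closure. The group compact asymptotic resemblance relation on $G$ is: $A\lambda_{\mathcal{K}}B$ if there exists $K\in\mathcal{K}$ with $A\subseteq BK$ and $B\subseteq AK$ (for $A,B\subseteq G$, where $AB=\{gh\mid g\in A,h\in B\}$); similarly for $H$. Topological coupling: an action of a topological group $G$ on a locally compact space $X$ is continuous if the action map $G\times X\to X$ is continuous, cocompact if there is a compact $K\subseteq X$ with $GK=X$, and proper if $\{g\in G\mid gD\cap D\neq\emptyset\}$ has compact closure for every compact $D\subseteq X$ (analogously for right actions). If $G$ and $H$ act continuously, properly and cocompactly on the locally compact space $X$ from the left and from the right respectively, and the two actions commute, then $X$ is a topological coupling for $G$ and $H$. Set theoretic coupling: a generating family $\mathcal{F}$ on a group $G$ is a family of subsets of $G$, containing a nonempty set and closed under finite unions, products $AB$ and inverses $A^{-1}=\{g^{-1}\mid g\in A\}$, with $G=\bigcup_{F\in\mathcal{F}}F$ (the family of subsets with compact closure is one); $\hat{\mathcal{F}}$ denotes the family of all subsets of members of $\mathcal{F}$, and $A\lambda_{\mathcal{F}}B$ means $A\subseteq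 BK$ and $B\subseteq AK$ for some $K\in\mathcal{F}$. Let $\mathcal{F}$, $\mathcal{L}$ be generating families on $G$, $H$. A nonempty set $X$ is a set theoretic coupling for $(G,\lambda_{\mathcal{F}})$ and $(H,\lambda_{\mathcal{L}})$ if $G$ acts on $X$ from the left and $H$ acts on $X$ from the right, these actions commute, and there exists $O\subseteq X$ such that: (i) $GO=OH=X$; (ii) for each $F\in\hat{\mathcal{F}}$ and $K\in\hat{\mathcal{L}}$, $\{g\in G\mid gOK\cap OK\neq\emptyset\}\in\hat{\mathcal{F}}$ and $\{h\in H\mid FOh\cap FO\neq\emptyset\}\in\hat{\mathcal{L}}$; (iii) for each $F\in\mathcal{F}$ there exists $E_H(F)\in\mathcal{L}$ with $FO\subseteq OE_H(F)$, and for each $K\in\mathcal{L}$ there exists $E_G(K)\in\mathcal{F}$ with $OK\subseteq E_G(K)O$. Here $\mathcal{F}$ and $\mathcal{L}$ are the families of subsets with compact closure in $G$ and $H$, and the actions are those of the topological coupling. *)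

(* Defs.v *)
From HB Require Import structures.
From mathcomp Require Import all_boot.
From mathcomp Require Import boolp classical_sets topology.

Set Implicit Arguments.
Unset Strict Implicit.
Unset Printing Implicit Defensive.

Local Open Scope classical_set_scope.

(* The library only has additive, commutative topological groups
   (topologicalZmodType).  Hausdorffness is not built in. *)
HB.mixin Record isTopologicalGroup G of Group G & Topological G := {
  mulg_continuous : continuous (fun x : G * G => (x.1 * x.2)%g) ;
  invg_continuous : continuous (fun x : G => x^-1%g)
}.

#[short(type="topologicalGroupType")]
HB.structure Definition TopologicalGroup :=
  {G of Group G & Topological G & isTopologicalGroup G}.

(* The product of two sets for a binary operation: AB in a group, FO for a left
   action, OK for a right action. *)
Notation "A `*[ op ] B" := [set op a b | a in A & b in B]
  (at level 40, op at level 200, format "A  `*[ op ]  B")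
  : classical_set_scope.

(* Every point has a compact neighbourhood.  The library's locally_compact
   asks for compact closed neighbourhoods, which is stronger in a space that is
   not assumed to be Hausdorff. *)
Definition has_compact_nbhs (X : topologicalType) :=
  forall x : X, exists2 K, nbhs x K & compact K.

Section Families.
Variable G : groupType.
Implicit Types (F : set (set G)) (A B : set G).

Record generating_family F : Prop := {
  gf_nonempty : exists2 A, F A & A !=set0 ;
  gf_setU : forall A B, F A -> F B -> F (A `|` B) ;
  gf_mul : forall A B, F A -> F B -> F (A `*[@mul G] B) ;
  gf_inv : forall A, F A -> F [set x^-1%g | x in A] ;
  gf_cover : \bigcup_(A in F) A = [set: G]
}.

Definition subset_hull F : set (set G) :=
  [set A | exists2 B, F B & A `<=` B].

Definition group_resemblance F A B : Prop :=
  exists2 K, F K & A `<=` B `*[@mul G] K /\ B `<=` A `*[@mul G] K.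

(* The resemblance relation of a generating family determines the hull of the
   family, so that a coupling may be expressed by the families alone. *)
Lemma group_resemblance_set1 F A : generating_family F ->
  group_resemblance F A [set 1%g] <-> A !=set0 /\ subset_hull F A.
Proof.
move=> Fgen; split=> [[K FK [AK KA]]|[[a Aa] [B FB AB]]].
  split; first by have [a Aa _] := KA _ erefl; exists a.
  by exists K => // a /AK[_ -> [k Kk <-]]; rewrite mul1g.
exists (B `|` [set x^-1%g | x in B]).
  by apply: gf_setU => //; exact: gf_inv.
split=> [x Ax|_ ->].
  by exists 1%g => //; exists x; [left; exact: AB|exact: mul1g].
exists a => //; exists a^-1%g; last exact: mulgV.
by right; exists a => //; exact: AB.
Qed.

End Families.

Section Actions.
Variables (G H : groupType) (X : Type).

Definition is_left_action (actl : G -> X -> X) : Prop :=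
  (forall x, actl 1%g x = x) /\
  (forall g h x, actl (g * h)%g x = actl g (actl h x)).

Definition is_right_action (actr : X -> H -> X) : Prop :=
  (forall x, actr x 1%g = x) /\
  (forall x g h, actr x (g * h)%g = actr (actr x g) h).

Definition actions_commute (actl : G -> X -> X) (actr : X -> H -> X) : Prop :=
  forall g x h, actr (actl g x) h = actl g (actr x h).

Record set_theoretic_coupling (F : set (set G)) (L : set (set H))
    (actl : G -> X -> X) (actr : X -> H -> X) : Prop := {
  stc_genl : generating_family F ;
  stc_genr : generating_family L ;
  stc_nonempty : [set: X] !=set0 ;
  stc_actl : is_left_action actl ;
  stc_actr : is_right_action actr ;
  stc_commute : actions_commute actl actr ;
  stc_set : exists O : set X,
    [/\ [set: G] `*[actl] O = [set: X],
        O `*[actr] [set: H] = [set: X],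
        forall A K, subset_hull F A -> subset_hull L K ->
          subset_hull F [set g | actl g @` (O `*[actr] K)
                                 `&` O `*[actr] K !=set0] /\
          subset_hull L [set h | (actr^~ h) @` (A `*[actl] O)
                                 `&` A `*[actl] O !=set0],
        forall A, F A -> exists2 E, L E & A `*[actl] O `<=` O `*[actr] E
      & forall K, L K -> exists2 E, F E & O `*[actr] K `<=` E `*[actl] O]
}.

End Actions.

Definition compact_closure_family (G : topologicalType) : set (set G) :=
  [set A | compact (closure A)].
Arguments compact_closure_family : clear implicits.

Record topological_coupling (G H : topologicalGroupType) (X : topologicalType)
    (actl : G -> X -> X) (actr : X -> H -> X) : Prop := {
  tc_locally_compact : has_compact_nbhs X ;
  tc_actl : is_left_action actl ;
  tc_actr : is_right_action actr ;
  tc_commute : actions_commute actl actr ;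
  tc_continuousl : continuous (fun p : G * X => actl p.1 p.2) ;
  tc_continuousr : continuous (fun p : X * H => actr p.1 p.2) ;
  tc_properl : forall D, compact D ->
    compact (closure [set g | actl g @` D `&` D !=set0]) ;
  tc_properr : forall D, compact D ->
    compact (closure [set h | (actr^~ h) @` D `&` D !=set0]) ;
  tc_cocompactl :
    exists2 K, compact K & [set: G] `*[actl] K = [set: X] ;
  tc_cocompactr :
    exists2 K, compact K & K `*[actr] [set: H] = [set: X]
}.

(* Main.v *)
(* Take for O the union of two compact sets, one meeting every G-orbit and the
   other every H-orbit.  If D is compact and contains O, then every point of D
   is o h with o in O, and such an h satisfies D h `&` D !=set0; properness
   thus confines h to a set with compact closure. *)
Require Import Defs.
From mathcomp Require Import all_boot.
From mathcomp Require Import boolp classical_sets topology.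

Local Open Scope classical_set_scope.

Lemma compact_mulset (X Y Z : topologicalType) (op : X -> Y -> Z)
    (A : set X) (B : set Y) :
  continuous (fun p : X * Y => op p.1 p.2) -> compact A -> compact B ->
  compact (A `*[op] B).
Proof.
move=> op_cont cA cB.
have -> : A `*[op] B = (fun p : X * Y => op p.1 p.2) @` (A `*` B).
  apply/seteqP; split=> z.
    by move=> [a Aa [b Bb <-]]; exists (a, b).
  by move=> [[a b] [/= Aa Bb] <-]; exists a => //; exists b.
apply: continuous_compact; last exact: compact_setX.
exact: continuous_subspaceT.
Qed.

Lemma mulset_sub (X Y Z : Type) (op : X -> Y -> Z) (A A' : set X)
    (B B' : set Y) :
  A `<=` A' -> B `<=` B' -> A `*[op] B `<=` A' `*[op] B'.
Proof.
by move=> sA sB _ [a /sA Aa [b /sB Bb <-]]; exists a => //; exists b.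
Qed.

Lemma compact_closure_sub (X : topologicalType) (A B : set X) :
  A `<=` B -> compact (closure B) -> compact (closure A).
Proof.
move=> AB cB; apply: (subclosed_compact _ cB); first exact: closed_closure.
exact: closureS.
Qed.

(** Compact sets are closed in a Hausdorff space, so [closure A] cannot leave [B]. *)
Lemma hausdorff_compact_closure (X : topologicalType) (A B : set X) :
  hausdorff_space X -> A `<=` B -> compact B -> compact (closure A).
Proof.
move=> hX AB cB; apply: (compact_closure_sub _ _ _ AB).
by rewrite -(closure_id B).1 //; exact: compact_closed.
Qed.

(** Passing to the hull adds nothing here, because having compact closure is inherited by
    subsets. *)
Lemma subset_hull_compact_closure (G : topologicalGroupType) (A : set G) :
  subset_hull (compact_closure_family G) A -> compact (closure A).
Proof. by move=> [B cB AB]; exact: compact_closure_sub _ _ _ AB cB. Qed.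

(** For products and inverses, the operation is applied to the closures: the result is compact by
    continuity and contains the set in question, so Hausdorffness bounds the closure of that set. *)
Lemma generating_compact_closure (G : topologicalGroupType) :
  hausdorff_space G -> generating_family (compact_closure_family G).
Proof.
move=> hG.
have set1_cc x : compact_closure_family G [set x].
  by apply: (hausdorff_compact_closure _ _ [set x]) => //; exact: compact_set1.
split.
- by exists [set 1%g]; [exact: set1_cc | exists 1%g].
- move=> A B cA cB; rewrite /compact_closure_family /= closureU.
  exact: compactU.
- move=> A B cA cB.
  apply: (hausdorff_compact_closure _ _ (closure A `*[@mul G] closure B)) => //.
    by apply: mulset_sub; exact: subset_closure.
  by apply: compact_mulset => //; exact: mulg_continuous.
- move=> A cA.
  apply: (hausdorff_compact_closure _ _ [set x^-1%g | x in closure A]) => //.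
    by apply: image_subset; exact: subset_closure.
  apply: continuous_compact => //.
  by apply: continuous_subspaceT; exact: invg_continuous.
- by apply/seteqP; split=> // x _; exists [set x].
Qed.

(** This carries properness from compact sets to their subsets. An arbitrary family of self-maps [f]
    covers the left action and the flipped right action at once. *)
Lemma meeting_set_sub (T X : Type) (f : T -> X -> X) (D E : set X) :
  D `<=` E ->
  [set t | f t @` D `&` D !=set0] `<=` [set t | f t @` E `&` E !=set0].
Proof.
move=> DE t [x [[y Dy <-] Dfy]]; exists (f t y); split; last exact: DE.
by exists y => //; exact: DE.
Qed.

Theorem proposition5p5 (G H : topologicalGroupType) (X : topologicalType)
    (actl : G -> X -> X) (actr : X -> H -> X)
    (hG : hausdorff_space G) (hH : hausdorff_space H)
    (X0 : [set: X] !=set0) (hX : topological_coupling actl actr) :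
  set_theoretic_coupling (compact_closure_family G) (compact_closure_family H)
    actl actr.
Proof.
case: hX => _ al ar comm contl contr properl properr [K1 cK1 GK1] [K2 cK2 K2H].
split=> //; [exact: generating_compact_closure..|].
set O := K1 `|` K2.
have cO : compact O by exact: compactU.
have GO : [set: G] `*[actl] O = [set: X].
  by apply/seteqP; split=> //; rewrite -GK1; apply: mulset_sub => // x; left.
have OH : O `*[actr] [set: H] = [set: X].
  by apply/seteqP; split=> //; rewrite -K2H; apply: mulset_sub => // x; right.
(* [A] need not be compact, so it is enlarged to its closure; the product with [O] is then a compact
   set to which properness applies. *)
have FOc A : compact (closure A) -> compact (closure A `*[actl] O).
  by move=> cA; exact: compact_mulset.
have OKc K : compact (closure K) -> compact (O `*[actr] closure K).
  by move=> cK; exact: compact_mulset.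
exists O; split=> //.
- move=> A K /(subset_hull_compact_closure G) cA /(subset_hull_compact_closure H) cK.
  split.
    exists [set g | actl g @` (O `*[actr] closure K)
                    `&` O `*[actr] closure K !=set0].
      by apply: properl; exact: OKc.
    by apply: meeting_set_sub; apply: mulset_sub => //; exact: subset_closure.
  exists [set h | (actr^~ h) @` (closure A `*[actl] O)
                  `&` closure A `*[actl] O !=set0].
    by apply: properr; exact: FOc.
  apply: (meeting_set_sub _ _ (fun h => actr^~ h)).
  by apply: mulset_sub => //; exact: subset_closure.
(* [O] is added to [D] because [A] need not contain the identity, so [closure A *[actl] O] may miss
   points of [O]. *)
- move=> A cA; set D := closure A `*[actl] O `|` O.
  exists [set h | (actr^~ h) @` D `&` D !=set0].
    by apply: properr; apply: compactU => //; exact: FOc.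
  move=> x AOx; have : [set: X] x by [].
  rewrite -OH => -[o Oo [h _ ohx]]; exists o => //; exists h => //.
  (* The common point of [D h] and [D] is [x] itself: it is [o h] with [o] in [O], and it lies in
     the product with [closure A]. *)
  exists x; split; first by exists o => //; right.
  by left; apply: (mulset_sub _ _ _ _ _ _ _ _ _ _ _ AOx) => //; exact: subset_closure.
(* The mirror case: [GO] writes the point as [g o], and properness of the left action bounds [g]. *)
- move=> K cK; set D := O `*[actr] closure K `|` O.
  exists [set g | actl g @` D `&` D !=set0].
    by apply: properl; apply: compactU => //; exact: OKc.
  move=> x OKx; have : [set: X] x by [].
  rewrite -GO => -[g _ [o Oo gox]]; exists g; last by exists o.
  exists x; split; first by exists o => //; right.
  by left; apply: (mulset_sub _ _ _ _ _ _ _ _ _ _ _ OKx) => //; exact: subset_closure.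
Qed.
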